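(* Let $T_1$ and $T_2$ be two $2\times 2$ contingency tables. Then Simpson's paradox does not hold for $T_1$ and $T_2$ if and only if both of the following implications hold: $$(\kappa(T_1)>1)\wedge(\kappa(T_2)>1)\ \text{ implies }\ \kappa(T_1+T_2)>1,$$ and $$(\kappa(T_1)<1)\wedge(\kappa(T_2)<1)\ \text{ implies }\ \kappa(T_1+T_2)<1.$$
   Context: A $2\times 2$ contingency table $T=\begin{pmatrix} a & b\\ c& d\end{pmatrix}$ has entries that are positive real numbers; its odds ratio is $\kappa(T)=(ad)/(bc)$. For two such tables $T_i=\begin{pmatrix} a_i & b_i\\ c_i& d_i\end{pmatrix}$, $i=1,2$, the aggregated table $T_1+T_2$ is the entrywise sum. Put $A_i=\frac{a_i}{a_i+b_i}$, $C_i=\frac{c_i}{c_i+d_i}$ for $i=1,2$, and $\mu=\frac{a_1+a_2}{a_1+b_1+a_2+b_2}$, $\nu=\frac{c_1+c_2}{c_1+d_1+c_2+d_2}$. Simpson's paradox (SP) is said to occur (hold) for $T_1$ and $T_2$ if at least one of the following holds: (SP$_1$) $A_1>C_1$ and $A_2>C_2$ and not $(\mu>\nu)$; (SP$_2$) $A_1<C_1$ and $A_2<C_2$ and not $(\mu<\nu)$. *)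

(* Defs.v *)
From HB Require Import structures.
From mathcomp Require Import all_boot all_order all_algebra.
From mathcomp Require Import reals.

Set Implicit Arguments.
Unset Strict Implicit.
Unset Printing Implicit Defensive.

Import Order.TTheory GRing.Theory Num.Theory.
Local Open Scope ring_scope.

(* For T = (a b; c d) : 'M[R]_2 we have a = T 0 0, b = T 0 1, c = T 1 0 and
   d = T 1 1. The aggregated table is the matrix sum T1 + T2. *)

Definition contingency_table (R : realType) (T : 'M[R]_2) : Prop :=
  forall i j : 'I_2, 0 < T i j.

Definition odds_ratio (R : realType) (T : 'M[R]_2) : R :=
  (T 0 0 * T 1 1) / (T 0 1 * T 1 0).

(* The quantity A_i of the table T_i is row_share T_i 0, and C_i is
   row_share T_i 1. *)
Definition row_share (R : realType) (T : 'M[R]_2) (r : 'I_2) : R :=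
  T r 0 / (T r 0 + T r 1).

(* The quantity mu is pooled_share T1 T2 0, and nu is pooled_share T1 T2 1. *)
Definition pooled_share (R : realType) (T1 T2 : 'M[R]_2) (r : 'I_2) : R :=
  (T1 r 0 + T2 r 0) / (T1 r 0 + T1 r 1 + T2 r 0 + T2 r 1).

Definition SP1 (R : realType) (T1 T2 : 'M[R]_2) : Prop :=
  [/\ row_share T1 0 > row_share T1 1,
      row_share T2 0 > row_share T2 1 &
      ~ (pooled_share T1 T2 0 > pooled_share T1 T2 1)].

Definition SP2 (R : realType) (T1 T2 : 'M[R]_2) : Prop :=
  [/\ row_share T1 0 < row_share T1 1,
      row_share T2 0 < row_share T2 1 &
      ~ (pooled_share T1 T2 0 < pooled_share T1 T2 1)].

Definition simpson_paradox (R : realType) (T1 T2 : 'M[R]_2) : Prop :=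
  SP1 T1 T2 \/ SP2 T1 T2.

(* Main.v *)
Require Import Defs.
From HB Require Import structures.
From mathcomp Require Import all_boot all_order all_algebra.
From mathcomp Require Import reals.

Set Implicit Arguments.
Unset Strict Implicit.
Unset Printing Implicit Defensive.

Import Order.TTheory GRing.Theory Num.Theory.
Local Open Scope ring_scope.

(* Both [1 < (a d)/(b c)] and [c/(c+d) < a/(a+b)] amount to [b c < a d] after
   clearing positive denominators, and likewise with the inequalities reversed.
   Since the pooled shares are the row shares of the aggregated table, the
   theorem reduces to propositional logic. *)

Lemma ltr_pdiv2 (R : realFieldType) (x y z w : R) :
  0 < z -> 0 < w -> (x / z < y / w) = (x * w < y * z).
Proof. by move=> z0 w0; rewrite ltr_pdivrMr // mulrAC ltr_pdivlMr. Qed.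

Lemma contingency_tableD (R : realType) (T1 T2 : 'M[R]_2) :
  contingency_table T1 -> contingency_table T2 -> contingency_table (T1 + T2).
Proof. by move=> h1 h2 i j; rewrite mxE addr_gt0. Qed.

Lemma pooled_shareE (R : realType) (T1 T2 : 'M[R]_2) (r : 'I_2) :
  pooled_share T1 T2 r = row_share (T1 + T2) r.
Proof. by rewrite /pooled_share /row_share !mxE -addrA addrACA. Qed.

Lemma odds_ratio_gt1 (R : realType) (T : 'M[R]_2) : contingency_table T ->
  (1 < odds_ratio T) = (row_share T 1 < row_share T 0).
Proof.
move=> hT; rewrite /odds_ratio /row_share ltr_pdiv2 ?addr_gt0 //.
(* Cross-multiplying the shares gives [c * (a + b) < a * (c + d)]; the product [a * c] occurs on
   both sides and cancels, which leaves [b * c < a * d]. *)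
rewrite ltr_pdivlMr ?mulr_gt0 // mul1r !mulrDr [T 1 0 * T 0 0]mulrC ltrD2l.
by rewrite [T 1 0 * _]mulrC.
Qed.

Lemma odds_ratio_lt1 (R : realType) (T : 'M[R]_2) : contingency_table T ->
  (odds_ratio T < 1) = (row_share T 0 < row_share T 1).
Proof.
move=> hT; rewrite /odds_ratio /row_share ltr_pdiv2 ?addr_gt0 //.
rewrite ltr_pdivrMr ?mulr_gt0 // mul1r !mulrDr [T 1 0 * T 0 0]mulrC ltrD2l.
by rewrite [T 1 0 * _]mulrC.
Qed.

Theorem theorem4 (R : realType) (T1 T2 : 'M[R]_2)
    (hT1 : contingency_table T1) (hT2 : contingency_table T2) :
  ~ simpson_paradox T1 T2 <->
  (odds_ratio T1 > 1 /\ odds_ratio T2 > 1 -> odds_ratio (T1 + T2) > 1) /\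
  (odds_ratio T1 < 1 /\ odds_ratio T2 < 1 -> odds_ratio (T1 + T2) < 1).
Proof.
(* Positivity of the sum lets the odds-ratio criteria apply to [T1 + T2] as well. *)
have hT := contingency_tableD hT1 hT2.
rewrite /simpson_paradox /SP1 /SP2 !pooled_shareE.
rewrite !odds_ratio_gt1 // !odds_ratio_lt1 //.
split=> [noSP|[gtP ltP] [[gt1 gt2]|[lt1 lt2]]]; last 2 first.
- by apply; apply: gtP.
- by apply; apply: ltP.
(* Comparisons are boolean, so each conclusion may be proved by contradiction: its negation is
   exactly the third clause of [SP1] or [SP2]. *)
split=> -[h1 h2]; apply: contraT => /negP h; case: noSP.
- by left.
- by right.
Qed.
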